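(* Let $R$ be a Noetherian commutative ring. Let $P$ be a prime ideal of $R$ of height $g\geq 2$, let $k\geq 2$ be an integer, and let $J=(z_1,\dots,z_g)$ be an ideal generated by a regular sequence $z_1,\dots,z_g$ contained in $P^{(k)}$. Set $I_k=J:P^{(k)}$. Then $I_k^2=I_kJ$ if one of the following conditions holds: (i) $R_P$ is not a regular local ring. (ii) $R_P$ is a regular local ring and $g\geq 3$. (iii) $R_P$ is a regular local ring, $g=2$, and $z_i\in P^{(k+1)}$ for every $i$.
   Context: For ideals $A,B$ of $R$, $A:B=\{r\in R : rB\subseteq A\}$. For a prime ideal $P$ and $n\geq 1$, $P^{(n)}$ denotes the $n$-th symbolic power of $P$, i.e. the preimage of $P^nR_P$ under the localization map $R\to R_P$. *)

(* Defs.v *)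
From HB Require Import structures.
From mathcomp Require Import all_boot all_order all_algebra.
From mathcomp Require Import boolp classical_sets.
From mathcomp Require Import ring.

Set Implicit Arguments.
Unset Strict Implicit.
Unset Printing Implicit Defensive.

Import GRing.Theory.
Local Open Scope ring_scope.
Local Open Scope classical_set_scope.

(* Ideals are Prop-valued subsets and may be the whole ring; the ideals of
   ring_quotient are excluded here because they are boolean and proper. *)
Definition is_ideal (R : comNzRingType) (I : set R) : Prop :=
  [/\ I 0, forall x y, I x -> I y -> I (x + y) & forall a x, I x -> I (a * x)].

Definition ideal_gen (R : comNzRingType) (A : set R) : set R :=
  smallest (@is_ideal R) A.

Definition ideal_mul (R : comNzRingType) (I J : set R) : set R :=
  ideal_gen [set x | exists a b, [/\ I a, J b & x = a * b]].

Definition ideal_pow (R : comNzRingType) (I : set R) (n : nat) : set R :=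
  iter n (ideal_mul I) setT.

Definition ideal_colon (R : comNzRingType) (A B : set R) : set R :=
  [set r | forall b, B b -> A (r * b)].

Definition noetherian (R : comNzRingType) : Prop :=
  forall I : set R, is_ideal I -> exists s : seq R, I = ideal_gen [set` s].

Definition is_prime_ideal (R : comNzRingType) (P : set R) : Prop :=
  [/\ is_ideal P, ~ P 1 & forall x y, P (x * y) -> P x \/ P y].

Record primeIdeal (R : comNzRingType) := PrimeIdeal {
  prime_set :> set R;
  prime_setP : is_prime_ideal prime_set }.

Definition is_maximal_ideal (R : comNzRingType) (M : set R) : Prop :=
  [/\ is_ideal M, ~ M 1 &
      forall I, is_ideal I -> M `<=` I -> ~ I 1 -> I = M].

(* p 0, ..., p n; the values of p beyond n are irrelevant. *)
Definition prime_chain (R : comNzRingType) (n : nat) (p : nat -> set R) :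
    Prop :=
  (forall i, (i <= n)%N -> is_prime_ideal (p i)) /\
  (forall i, (i < n)%N -> p i `<` p i.+1).

Definition has_height (R : comNzRingType) (P : set R) (g : nat) : Prop :=
  (exists p, prime_chain g p /\ p g = P) /\
  (forall n p, prime_chain n p -> p n = P -> (n <= g)%N).

Definition has_krull_dim (R : comNzRingType) (d : nat) : Prop :=
  (exists p : nat -> set R, prime_chain d p) /\
  (forall n (p : nat -> set R), prime_chain n p -> (n <= d)%N).

Definition regular_local_ring (R : comNzRingType) : Prop :=
  noetherian R /\
  exists M : set R,
    [/\ is_maximal_ideal M,
        forall N : set R, is_maximal_ideal N -> N = M &
        exists (d : nat) (x : 'I_d -> R),
          has_krull_dim R d /\ M = ideal_gen (range x)].

Definition regular_sequence (R : comNzRingType) (g : nat) (z : 'I_g -> R) :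
    Prop :=
  (forall (i : 'I_g) (r : R),
     ideal_gen (z @` [set j : 'I_g | (j < i)%N]) (z i * r) ->
     ideal_gen (z @` [set j : 'I_g | (j < i)%N]) r) /\
  ~ ideal_gen (range z) 1.

Module Localization.
Section Localization.
Variables (R : comNzRingType) (P : primeIdeal R).

Definition denom := {s : R | `[< ~ prime_set P s >]}.
Definition ratio := (R * denom)%type.

Lemma denomP (s : denom) : ~ prime_set P (sval s).
Proof. by case: s => s /= /asboolP. Qed.

Lemma denom1_subproof : `[< ~ prime_set P 1 >].
Proof. by apply/asboolP; case: (prime_setP P). Qed.

Lemma denomM_subproof (s t : denom) : `[< ~ prime_set P (sval s * sval t) >].
Proof.
apply/asboolP; case: (prime_setP P) => _ _ PM /PM [].
  exact: denomP.
exact: denomP.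
Qed.

Definition denom1 : denom :=
  @exist R (fun s => `[< ~ prime_set P s >]) 1 denom1_subproof.
Definition denomM (s t : denom) : denom :=
  @exist R (fun s => `[< ~ prime_set P s >]) (sval s * sval t)
    (denomM_subproof s t).

Definition eqv (x y : ratio) : bool :=
  `[< exists u : denom,
        sval u * (x.1 * sval y.2) = sval u * (y.1 * sval x.2) >].

Lemma eqv_refl : reflexive eqv.
Proof. by move=> x; apply/asboolP; exists denom1. Qed.

Lemma eqv_sym : symmetric eqv.
Proof. by move=> x y; apply/asboolP/asboolP => -[u hu]; exists u. Qed.

Lemma eqv_trans : transitive eqv.
Proof.
move=> y x z /asboolP[u hu] /asboolP[v hv]; apply/asboolP.
exists (denomM (denomM u v) y.2) => /=.
transitivity ((sval u * (x.1 * sval y.2)) * (sval v * sval z.2)); first by ring.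
rewrite hu.
transitivity ((sval v * (y.1 * sval z.2)) * (sval u * sval x.2)); first by ring.
by rewrite hv; ring.
Qed.

Canonical eqv_equiv := EquivRel eqv eqv_refl eqv_sym eqv_trans.

Definition type := {eq_quot eqv}%qT.
HB.instance Definition _ : EqQuotient _ eqv type := EqQuotient.on type.
HB.instance Definition _ := Choice.on type.

Definition mk (x : ratio) : type := (\pi_type x)%qT.

Lemma mkP (x y : ratio) :
  mk x = mk y <->
  exists u : denom, sval u * (x.1 * sval y.2) = sval u * (y.1 * sval x.2).
Proof.
split=> [/eqmodP /asboolP //|h].
by apply/eqmodP/asboolP.
Qed.

Lemma mk_repr (a : type) : mk (repr a) = a.
Proof. exact: reprK. Qed.

Definition zero : type := mk (0, denom1).
Definition one : type := mk (1, denom1).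
Definition addf (x y : ratio) : ratio :=
  (x.1 * sval y.2 + y.1 * sval x.2, denomM x.2 y.2).
Definition mulf (x y : ratio) : ratio := (x.1 * y.1, denomM x.2 y.2).
Definition oppf (x : ratio) : ratio := (- x.1, x.2).
Definition add (a b : type) : type := mk (addf (repr a) (repr b)).
Definition mul (a b : type) : type := mk (mulf (repr a) (repr b)).
Definition opp (a : type) : type := mk (oppf (repr a)).

Lemma mk_add x y : add (mk x) (mk y) = mk (addf x y).
Proof.
have /mkP[u hu] := mk_repr (mk x); have /mkP[v hv] := mk_repr (mk y).
move: hu hv; rewrite /add; set x' := repr (mk x); set y' := repr (mk y).
move=> hu hv; apply/mkP; exists (denomM u v) => /=.
transitivity ((sval u * (x'.1 * sval x.2)) * (sval v * sval y'.2 * sval y.2)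
  + (sval v * (y'.1 * sval y.2)) * (sval u * sval x'.2 * sval x.2)).
  by ring.
by rewrite hu hv; ring.
Qed.

Lemma mk_mul x y : mul (mk x) (mk y) = mk (mulf x y).
Proof.
have /mkP[u hu] := mk_repr (mk x); have /mkP[v hv] := mk_repr (mk y).
move: hu hv; rewrite /mul; set x' := repr (mk x); set y' := repr (mk y).
move=> hu hv; apply/mkP; exists (denomM u v) => /=.
transitivity ((sval u * (x'.1 * sval x.2)) * (sval v * (y'.1 * sval y.2))).
  by ring.
by rewrite hu hv; ring.
Qed.

Lemma mk_opp x : opp (mk x) = mk (oppf x).
Proof.
have /mkP[u hu] := mk_repr (mk x).
move: hu; rewrite /opp; set x' := repr (mk x).
by move=> hu; apply/mkP; exists u; rewrite /= !mulNr !mulrN hu.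
Qed.

Lemma mk_ind (Q : type -> Prop) : (forall x, Q (mk x)) -> forall a, Q a.
Proof. by move=> h a; rewrite -(mk_repr a). Qed.

Lemma addA : associative add.
Proof.
elim/mk_ind=> x; elim/mk_ind=> y; elim/mk_ind=> z; rewrite !mk_add.
by apply/mkP; exists denom1 => /=; ring.
Qed.

Lemma addC : commutative add.
Proof.
elim/mk_ind=> x; elim/mk_ind=> y; rewrite !mk_add.
by apply/mkP; exists denom1 => /=; ring.
Qed.

Lemma add0 : left_id zero add.
Proof.
elim/mk_ind=> x; rewrite mk_add.
by apply/mkP; exists denom1 => /=; ring.
Qed.

Lemma addN : left_inverse zero opp add.
Proof.
elim/mk_ind=> x; rewrite mk_opp mk_add.
by apply/mkP; exists denom1 => /=; ring.
Qed.

HB.instance Definition _ := GRing.isZmodule.Build type addA addC add0 addN.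

Lemma mulA : associative mul.
Proof.
elim/mk_ind=> x; elim/mk_ind=> y; elim/mk_ind=> z; rewrite !mk_mul.
by apply/mkP; exists denom1 => /=; ring.
Qed.

Lemma mulC : commutative mul.
Proof.
elim/mk_ind=> x; elim/mk_ind=> y; rewrite !mk_mul.
by apply/mkP; exists denom1 => /=; ring.
Qed.

Lemma mul1 : left_id one mul.
Proof.
elim/mk_ind=> x; rewrite mk_mul.
by apply/mkP; exists denom1 => /=; ring.
Qed.

Lemma mulDl : left_distributive mul add.
Proof.
elim/mk_ind=> x; elim/mk_ind=> y; elim/mk_ind=> z; rewrite !(mk_add, mk_mul).
by apply/mkP; exists denom1 => /=; ring.
Qed.

Lemma one_neq0 : one != 0 :> type.
Proof.
apply/eqP => /mkP[u /=]; rewrite !mulr1 mulr0 => u0.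
by apply: (denomP (s := u)); rewrite u0; case: (prime_setP P) => -[].
Qed.

HB.instance Definition _ :=
  GRing.Zmodule_isComNzRing.Build type mulA mulC mul1 mulDl one_neq0.

Definition to_loc (r : R) : type := mk (r, denom1).

Lemma to_loc_is_zmod_morphism : zmod_morphism to_loc.
Proof.
move=> x y; transitivity (add (mk (x, denom1)) (opp (mk (y, denom1)))) => //.
rewrite mk_opp mk_add.
by apply/mkP; exists denom1 => /=; ring.
Qed.

HB.instance Definition _ :=
  GRing.isZmodMorphism.Build R type to_loc to_loc_is_zmod_morphism.

Lemma to_loc_is_monoid_morphism : monoid_morphism to_loc.
Proof.
split=> // x y; transitivity (mul (mk (x, denom1)) (mk (y, denom1))) => //.
rewrite mk_mul.
by apply/mkP; exists denom1 => /=; ring.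
Qed.

HB.instance Definition _ :=
  GRing.isMonoidMorphism.Build R type to_loc to_loc_is_monoid_morphism.

End Localization.
End Localization.
HB.export Localization.

Notation localization := Localization.type.
Notation to_loc := Localization.to_loc.

Definition symbolic_power (R : comNzRingType) (P : primeIdeal R) (n : nat) :
    set R :=
  to_loc P @^-1` ideal_gen (to_loc P @` ideal_pow P n).

(* Main.v *)
(* The ideals are compared after localizing at P.  Let (A, m) be the local ring
   R_P and let x multiply m^k into J A.  The main point is that, for p in m^k,
   the coefficients b_i in p x = sum b_i z_i lie in m^k.  This gives x in m^k
   (take p = z_1); so for x, y in I_k one has x y = sum a_i z_i, and the
   relations sum (p a_i - b_i y) z_i = 0 put p a_i in J, i.e. a_i in I_k.

   For the coefficients of two elements a, b of the sequence, work modulo the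
   others.  An element g with g m^n in (a, b) induces, for each z in m^n, a
   homomorphism m^n -> A/(z), and one shows by induction on n that its image
   lies in m^n.  Writing z as a combination of elements of m^(n-1) with
   coefficients in m, the induction hypothesis shows that multiplying an
   argument in m^(n-1) by u in m changes the value, modulo m^n, into a scalar
   r_u times the argument.  If no r_u is a unit this is the claim; otherwise
   m^(n-1) is generated by u^(n-1), which cannot contain a regular sequence of
   length two.  The initial case n = 1 only fails when m is generated by u and
   z modulo the other elements of the sequence: then A is regular of dimension
   two if g = 2, and for g >= 3 the ideal m contains three regular elements
   modulo an ideal over which it is generated by two.  If all z_i are in
   m^(k+1) one may take z in m^2, so that m would be generated by u. *)

Require Import Defs.
From mathcomp Require Import all_boot all_order all_algebra.
From mathcomp Require Import boolp classical_sets.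
From mathcomp Require Import ring.

Set Implicit Arguments.
Unset Strict Implicit.
Unset Printing Implicit Defensive.

Import GRing.Theory.
Local Open Scope ring_scope.
Local Open Scope classical_set_scope.

(** * Ideals *)

Section Ideals.
Variable A : comNzRingType.
Implicit Types (I J K L m : set A) (x y r : A) (s t : seq A).

Lemma ideal0 I : is_ideal I -> I 0. Proof. by case. Qed.

Lemma idealD I x y : is_ideal I -> I x -> I y -> I (x + y).
Proof. by case=> _ + _; apply. Qed.

Lemma idealMl I r x : is_ideal I -> I x -> I (r * x).
Proof. by case=> _ _; apply. Qed.

Lemma idealMr I r x : is_ideal I -> I x -> I (x * r).
Proof. by rewrite mulrC; apply: idealMl. Qed.

Lemma idealN I x : is_ideal I -> I x -> I (- x).
Proof. by rewrite -mulN1r; apply: idealMl. Qed.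

Lemma idealB I x y : is_ideal I -> I x -> I y -> I (x - y).
Proof. by move=> hI hx hy; apply: idealD => //; apply: idealN. Qed.

Lemma ideal_sum I (T : Type) (r : seq T) (Q : pred T) (F : T -> A) :
  is_ideal I -> (forall i, Q i -> I (F i)) -> I (\sum_(i <- r | Q i) F i).
Proof.
by move=> hI hF; elim/big_ind: _ => // [|x y]; [apply: ideal0|apply: idealD].
Qed.

Lemma is_ideal0 : is_ideal [set 0 : A].
Proof.
split=> [//|x y -> ->|a x ->] /=; first by rewrite addr0.
by rewrite mulr0.
Qed.

Lemma is_idealT : is_ideal [set: A]. Proof. by []. Qed.

Lemma ideal_gen_ideal (S : set A) : is_ideal (ideal_gen S).
Proof.
split=> [I [hI _]|x y hx hy I [hI hS]|a x hx I [hI hS]]; first exact: ideal0.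
  by apply: (idealD hI); [apply: hx|apply: hy].
by apply: (idealMl _ hI); apply: hx.
Qed.

Lemma ideal_genW (S : set A) x : S x -> ideal_gen S x.
Proof. exact: sub_gen_smallest. Qed.

Lemma ideal_gen_sub (S I : set A) :
  is_ideal I -> S `<=` I -> ideal_gen S `<=` I.
Proof. exact: smallest_sub. Qed.

Lemma ideal_gen_rangeP (g : nat) (z : 'I_g -> A) (Q : pred 'I_g) x :
  ideal_gen (z @` [set j | Q j]) x <-> exists c, x = \sum_(j | Q j) c j * z j.
Proof.
split=> [|[c ->]]; last first.
  apply: ideal_sum; first exact: ideal_gen_ideal.
  move=> j Qj; apply: (idealMl _ (@ideal_gen_ideal _)).
  by apply: ideal_genW; exists j.
move: x; apply: (@ideal_gen_sub _
  [set x | exists c : 'I_g -> A, x = \sum_(j | Q j) c j * z j]).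
  split=> [|x1 x2 [c ->] [d ->]|a x1 [c ->]].
  - by exists (fun=> 0); rewrite big1 // => j _; rewrite mul0r.
  - exists (fun j => c j + d j); rewrite -big_split /=.
    by apply: eq_bigr => j _; rewrite mulrDl.
  - exists (fun j => a * c j); rewrite mulr_sumr.
    by apply: eq_bigr => j _; rewrite mulrA.
move=> _ [i Qi <-].
exists (fun j => (j == i)%:R); rewrite (bigD1 i) //= eqxx mul1r.
by rewrite big1 ?addr0 // => j /andP[_ /negPf ->]; rewrite mul0r.
Qed.

Lemma ideal_mul_ideal I J : is_ideal (ideal_mul I J).
Proof. exact: ideal_gen_ideal. Qed.

Lemma ideal_mulW I J x y : I x -> J y -> ideal_mul I J (x * y).
Proof. by move=> hx hy; apply: ideal_genW; exists x, y. Qed.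

Lemma ideal_mul_sub I J K : is_ideal K ->
  (forall x y, I x -> J y -> K (x * y)) -> ideal_mul I J `<=` K.
Proof.
by move=> hK h; apply: ideal_gen_sub => // _ [x [y [hx hy ->]]]; apply: h.
Qed.

Lemma ideal_pow_ideal I n : is_ideal (ideal_pow I n).
Proof. by case: n => [|n]; [apply: is_idealT|apply: ideal_mul_ideal]. Qed.

Lemma ideal_pow1 I : is_ideal I -> ideal_pow I 1 = I.
Proof.
move=> hI; apply/seteqP; split.
  by apply: ideal_mul_sub => // x y hx _; apply: idealMr.
by move=> x hx; rewrite -[x]mulr1; apply: ideal_mulW.
Qed.

Lemma ideal_powS I n : ideal_pow I n.+1 = ideal_mul I (ideal_pow I n).
Proof. by []. Qed.

Lemma ideal_pow_le I i j : (i <= j)%N -> ideal_pow I j `<=` ideal_pow I i.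
Proof.
move=> /subnK <-; elim: (j - i)%N => //= d IH x hx; apply: IH.
move: x hx; apply: ideal_mul_sub; first exact: ideal_pow_ideal.
by move=> x y _ hy; apply: idealMl => //; apply: ideal_pow_ideal.
Qed.

Lemma ideal_powD I i j x y :
  ideal_pow I i x -> ideal_pow I j y -> ideal_pow I (i + j) (x * y).
Proof.
move=> + hy; elim: i x => [|i IH] x hx.
  by apply: idealMl hy; apply: ideal_pow_ideal.
pose K := [set x | ideal_pow I (i.+1 + j) (x * y)].
have hK : is_ideal K.
  have hP := ideal_pow_ideal I (i.+1 + j).
  split=> [|u v hu hv|a u hu]; rewrite /K /mkset ?mul0r ?mulrDl -?mulrA.
  - exact: ideal0.
  - exact: (idealD hP).
  - exact: (idealMl _ hP).
apply: (ideal_mul_sub (K := K) hK _ hx) => u v hu hv.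
by rewrite /K /= -mulrA; apply: ideal_mulW => //; apply: IH.
Qed.

Lemma ideal_pow_expr I n x : is_ideal I -> I x -> ideal_pow I n (x ^+ n).
Proof.
by move=> hI hx; elim: n => // n IH; rewrite exprS; apply: ideal_mulW.
Qed.

End Ideals.

Ltac in_ideal :=
  first
  [ assumption
  | lazymatch goal with
    | |- is_ideal (ideal_pow _ _) => exact: ideal_pow_ideal
    | |- ?I 0 => refine (@ideal0 _ I _); in_ideal
    | |- ?I (?x - ?y) => refine (@idealB _ I x y _ _ _); in_ideal
    | |- ?I (?x + ?y) => refine (@idealD _ I x y _ _ _); in_ideal
    | |- ?I (- ?x) => refine (@idealN _ I x _ _); in_ideal
    | |- ?I (?x * ?y) =>
        first [ refine (@idealMl _ I x y _ _); in_ideal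
              | refine (@idealMr _ I y x _ _); in_ideal ]
    end ].

(** * Adjoining elements to an ideal *)

Section Adjunction.
Variable A : comNzRingType.
Implicit Types (I J K m : set A) (x y r : A) (s t : seq A).

(** The ideal I + (x), with the coefficient of x exposed. Quotients by ideals are never formed: a
    congruence modulo I is written as the membership of a difference. *)
Definition ideal_adj I x : set A := [set y | exists r, I (y - r * x)].

Lemma ideal_adj_ideal I x : is_ideal I -> is_ideal (ideal_adj I x).
Proof.
move=> hI; split=> [|y1 y2 [r1 h1] [r2 h2]|a y [r h]].
- by exists 0; rewrite mul0r subr0; apply: ideal0.
- exists (r1 + r2); rewrite (_ : _ - _ = (y1 - r1 * x) + (y2 - r2 * x));
    [exact: idealD|ring].
- exists (a * r); rewrite -mulrA -mulrBr; exact: idealMl.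
Qed.

Lemma sub_ideal_adj I x : is_ideal I -> I `<=` ideal_adj I x.
Proof. by move=> hI y hy; exists 0; rewrite mul0r subr0. Qed.

Lemma mem_ideal_adj I x : is_ideal I -> ideal_adj I x x.
Proof. by move=> hI; exists 1; rewrite mul1r subrr; apply: ideal0. Qed.

Lemma ideal_adj_sub I J x : is_ideal J -> I `<=` J -> J x ->
  ideal_adj I x `<=` J.
Proof.
move=> hJ IJ hx y [r hr]; rewrite -(subrK (r * x) y).
by apply: idealD => //; [apply: IJ|apply: idealMl].
Qed.

Lemma ideal_adjC I x y :
  is_ideal I -> ideal_adj (ideal_adj I x) y = ideal_adj (ideal_adj I y) x.
Proof.
move=> hI.
by apply/seteqP; split=> w [r [t h]]; exists t, r; rewrite addrAC.
Qed.

(** Elements are adjoined from the head, so that the recursion runs parallel to that of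
    [regular_mod]. *)
Fixpoint ideal_span I s : set A :=
  if s is x :: s' then ideal_span (ideal_adj I x) s' else I.

Lemma ideal_span_ideal I s : is_ideal I -> is_ideal (ideal_span I s).
Proof. by elim: s I => [|x s IH] //= I hI; apply/IH/ideal_adj_ideal. Qed.

Lemma sub_ideal_span I s : is_ideal I -> I `<=` ideal_span I s.
Proof.
elim: s I => [|x s IH] I hI /=; first exact: subset_refl.
apply: subset_trans (IH _ _).
  exact: sub_ideal_adj.
exact: ideal_adj_ideal.
Qed.

Lemma mem_ideal_span I s x : is_ideal I -> x \in s -> ideal_span I s x.
Proof.
elim: s I => //= y s IH I hI; have hJ := ideal_adj_ideal y hI.
rewrite inE => /orP[/eqP ->|]; last exact: IH.
by apply: sub_ideal_span => //; apply: mem_ideal_adj.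
Qed.

Lemma ideal_span_sub I J s : is_ideal J -> I `<=` J ->
  {in s, forall x, J x} -> ideal_span I s `<=` J.
Proof.
move=> hJ; elim: s I => [|x s IH] //= I IJ hs; apply: IH => [|y ys].
  by apply: ideal_adj_sub => //; apply: hs; rewrite mem_head.
by apply: hs; rewrite inE ys orbT.
Qed.

Lemma ideal_span_cat I s t :
  ideal_span I (s ++ t) = ideal_span (ideal_span I s) t.
Proof. by elim: s I => //=. Qed.

Lemma ideal_gen_span s : ideal_gen [set` s] = ideal_span [set 0] s.
Proof.
have hS := ideal_span_ideal s (is_ideal0 A).
apply/seteqP; split.
  by apply: ideal_gen_sub => // x /=; apply: mem_ideal_span; apply: is_ideal0.
have hG := ideal_gen_ideal [set` s].
apply: ideal_span_sub => //; first by move=> x ->; apply: ideal0.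
by move=> x xs; apply: ideal_genW.
Qed.

(** * Local rings *)

Section Local.
Variable m : set A.
Hypotheses (mI : is_ideal m) (m1 : ~ m 1).
Hypothesis munit : forall x, ~ m x -> exists y, y * x = 1.

(** Induction on the generators, with I growing: the induction hypothesis for I + (x) gives J inside
    I + (x), hence m J inside I + m x. So (1 - c) x lies in I for some c in m, and 1 - c is a
    unit. *)
Lemma nakayama_span I J s : is_ideal I -> is_ideal J -> {in s, forall x, J x} ->
  J `<=` ideal_span I s ->
  (forall x, J x -> exists y, I y /\ ideal_mul m J (x - y)) -> J `<=` I.
Proof.
move=> hI hJ; elim: s I hI => //= x s IH I hI hs hJs hJm.
have xJ : J x by apply: hs; rewrite mem_head.
have JIx : J `<=` ideal_adj I x.
  apply: IH => // [|y ys|y /hJm[e [he hy]]]; first exact: ideal_adj_ideal.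
    by apply: hs; rewrite inE ys orbT.
  by exists e; split => //; apply: sub_ideal_adj.
suff Ix : I x by move=> y /JIx; apply: ideal_adj_sub.
have [e [he hx]] := hJm x xJ.
have hK : is_ideal [set y | exists c, m c /\ I (y - c * x)].
  split=> [|y1 y2 [c [hc h1]] [d [hd h2]]|a y [c [hc h]]].
  - by exists 0; rewrite mul0r subr0; split; apply: ideal0.
  - exists (c + d); split; first exact: idealD.
    by rewrite mulrDl opprD addrACA; apply: idealD.
  - exists (a * c); split; first exact: idealMl.
    by rewrite -mulrA -mulrBr; apply: idealMl.
have [|c [hc h]] := ideal_mul_sub hK _ hx.
  move=> u v hu /JIx[r hr]; exists (u * r); split; first exact: idealMr.
  by rewrite -mulrA -mulrBr; apply: idealMl.
have [|y hy] := munit (x := 1 - c).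
  by move=> h1; apply: m1; rewrite -(subrK c 1); apply: idealD.
rewrite (_ : x = y * ((x - e - c * x) + e)).
  by apply: idealMl => //; apply: idealD.
by rewrite (_ : y * _ = (y * (1 - c)) * x); [rewrite hy mul1r|ring].
Qed.

Hypothesis hA : noetherian A.

Lemma nakayama I J : is_ideal I -> is_ideal J ->
  (forall x, J x -> exists y, I y /\ ideal_mul m J (x - y)) -> J `<=` I.
Proof.
move=> hI hJ h; have [s hs] := hA hJ; rewrite ideal_gen_span in hs.
apply: (@nakayama_span I J s) => //.
  by move=> x xs; rewrite hs; apply: mem_ideal_span (is_ideal0 A) xs.
rewrite {1}hs; apply: ideal_span_sub.
- exact: ideal_span_ideal.
- by move=> x ->; apply: ideal0; apply: ideal_span_ideal.
- by move=> x; apply: mem_ideal_span.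
Qed.

(** A weakly regular sequence on A / I: the quotient by all of [s] may be zero. *)
Fixpoint regular_mod I s : Prop :=
  if s is x :: s' then
    (forall r, I (x * r) -> I r) /\ regular_mod (ideal_adj I x) s'
  else True.

(** If y r is in I, then r = c x modulo I because y is regular modulo (I, x), and cancelling x puts
    c y in I. So the annihilator K of y modulo I satisfies K = x K modulo I, and Nakayama's lemma
    gives K = I. For the second element, a relation x r = c y forces c into (I, x), and x
    cancels. *)
Lemma regular_mod_swap I x y s : is_ideal I -> m x ->
  regular_mod I [:: x, y & s] -> regular_mod I [:: y, x & s].
Proof.
move=> hI mx /= [hx [hy hs]]; rewrite ideal_adjC //; split; last split => //.
- pose K := [set r | I (y * r)].
  have hK : is_ideal K.
    split=> [|u v hu hv|a u hu]; rewrite /K /=.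
    + by rewrite mulr0; apply: ideal0.
    + by rewrite mulrDr; apply: idealD.
    + by rewrite mulrCA; apply: idealMl.
  apply: (nakayama hI hK) => r yr.
  have [c hc] : ideal_adj I x r by apply: hy; apply: sub_ideal_adj.
  exists (r - c * x); split => //; rewrite subKr mulrC.
  apply: ideal_mulW => //; apply: hx; rewrite /= mulrCA.
  rewrite (_ : _ * _ = y * r - y * (r - c * x)); last by ring.
  by apply: idealB => //; apply: idealMl.
- move=> r [c hc].
  have [d hd] : ideal_adj I x c.
    apply: hy; exists r; rewrite (_ : _ - _ = - (x * r - c * y)); last by ring.
    exact: idealN.
  exists d; apply: hx; rewrite (_ : _ * _ = (x * r - c * y) + y * (c - d * x)).
    by apply: idealD => //; apply: idealMl.
  by ring.
Qed.

Lemma regular_mod_front I s x t : is_ideal I -> {in s, forall y, m y} ->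
  regular_mod I (s ++ x :: t) -> regular_mod I (x :: s ++ t).
Proof.
elim: s I => // y s IH I hI hs /= [hy h].
apply: regular_mod_swap => //; first by apply: hs; rewrite mem_head.
split=> //; apply: IH h; first exact: ideal_adj_ideal.
by move=> w ws; apply: hs; rewrite inE ws orbT.
Qed.

Lemma regular_mod_perm I s t : is_ideal I -> {in s, forall y, m y} ->
  perm_eq s t -> regular_mod I s -> regular_mod I t.
Proof.
elim: t I s => // x t IH I s hI hs st hr.
have xs : x \in s by rewrite (perm_mem st) mem_head.
move: xs hs st hr; case/path.splitPr => s1 s2 hs st hr.
have [hx hr'] : regular_mod I (x :: s1 ++ s2).
  apply: regular_mod_front => // y ys.
  by apply: hs; rewrite mem_cat ys.
split=> //; apply: IH hr'; first exact: ideal_adj_ideal.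
  move=> y; rewrite mem_cat => ys; apply: hs.
  by rewrite mem_cat inE orbCA ys orbT.
by rewrite -(perm_cons x) (perm_catCA [:: x] s1 s2).
Qed.

Lemma regular_mod_cat I s t : regular_mod I (s ++ t) ->
  regular_mod (ideal_span I s) t.
Proof. by elim: s I => [|x s IH] //= I [_ /IH]. Qed.

(** Vanishing of the first Koszul homology of a regular pair on A / I. It produces all the auxiliary
    elements of the arguments below. *)
Lemma regular_pair_rel I x y u v : is_ideal I -> regular_mod I [:: x; y] ->
  I (y * u - x * v) -> exists d, I (u - d * x) /\ I (v - d * y).
Proof.
move=> hI [hx [hy _]] h.
have [d hd] : ideal_adj I x u by apply: hy; exists v; rewrite [v * _]mulrC.
exists d; split=> //; apply: hx.
rewrite (_ : _ * _ = - (y * u - x * v) + y * (u - d * x)); last by ring.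
by apply: idealD; rewrite //; [apply: idealN|apply: idealMl].
Qed.

(** From y r1 = x r2 one gets r1 = d x, so x = c d x modulo I; cancelling x would put 1 - c d in I,
    although c is in m. *)
Lemma regular_pair_not_principal I x y c r1 r2 :
  is_ideal I -> I `<=` m -> regular_mod I [:: x; y] -> m c ->
  I (x - r1 * c) -> I (y - r2 * c) -> False.
Proof.
move=> hI Im hxy mc h1 h2.
have [|d [hd _]] := @regular_pair_rel I x y r1 r2 hI hxy.
  rewrite (_ : _ - _ = r1 * (y - r2 * c) - r2 * (x - r1 * c)); last by ring.
  by apply: idealB => //; apply: idealMl.
apply: m1; rewrite -(subrK (c * d) 1); apply: idealD => //; last exact: idealMr.
apply: Im; case: hxy => hx _; apply: hx.
rewrite (_ : _ * _ = (x - r1 * c) + c * (r1 - d * x)); last by ring.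
by apply: idealD => //; apply: idealMl.
Qed.

(* With [x = x1 u + x2 v] and so on, the minor [D = x1 y2 - x2 y1] satisfies
   [D w \in (x, y)], hence [D = p x + q y]; comparing the two expressions of
   [D u] and [D v] in terms of [x, y] makes [x] a multiple of itself by an
   element of [m]. *)
Lemma regular_triple_not_two_generated I x y w u v :
  is_ideal I -> I `<=` m -> regular_mod I [:: x; y; w] -> m u -> m v ->
  (forall r, m r -> ideal_adj (ideal_adj I u) v r) ->
  m x -> m y -> m w -> False.
Proof.
move=> hI Im hr mu mv muv /muv[x2 [x1 hx]] /muv[y2 [y1 hy]] /muv[w2 [w1 hw]].
have hxy : regular_mod I [:: x; y] by case: hr => ? [? _].
have [hx0 [_ [hw0 _]]] := hr.
set ex := x - x2 * v - x1 * u in hx.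
set ey := y - y2 * v - y1 * u in hy.
set ew := w - w2 * v - w1 * u in hw.
have [q [p hD]] : ideal_adj (ideal_adj I x) y (x1 * y2 - x2 * y1).
  apply: hw0; exists (x1 * w2 - x2 * w1), (- (y1 * w2 - y2 * w1)).
  rewrite (_ : _ - _ = (x1 * y2 - x2 * y1) * ew + (y1 * w2 - y2 * w1) * ex
    - (x1 * w2 - x2 * w1) * ey); last by rewrite /ex /ey /ew; ring.
  by apply: idealB; [|apply: idealD => //|]; rewrite //; apply: idealMl.
set eD := _ - _ - _ in hD.
have [|t [h1 h2]] := @regular_pair_rel I x y (x2 + q * u) (y2 - p * u) hI hxy.
  rewrite (_ : _ - _ = - u * eD + x2 * ey - y2 * ex);
    last by rewrite /ex /ey /eD; ring.
  by apply: idealB; [|apply: idealD => //|]; rewrite //; apply: idealMl.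
have [|t' [h1' h2']] := @regular_pair_rel I x y (q * v - x1) (- y1 - p * v)
    hI hxy.
  rewrite (_ : _ - _ = - v * eD + y1 * ex - x1 * ey);
    last by rewrite /ex /ey /eD; ring.
  by apply: idealB; [|apply: idealD => //|]; rewrite //; apply: idealMl.
apply: m1; rewrite -(subrK (t * v - t' * u) 1); apply: idealD => //; last first.
  by apply: idealB => //; apply: idealMl.
apply: Im; apply: hx0.
rewrite (_ : _ * _ = ex + v * (x2 + q * u - t * x) - u * (q * v - x1 - t' * x));
  last by rewrite /ex; ring.
by apply: idealB; [|apply: idealD => //|]; rewrite //; apply: idealMl.
Qed.

End Local.
End Adjunction.

(** * The colon ideal of a power of the maximal ideal *)

Section Core.
Variable A : comNzRingType.
(** Here [a] and [b] stand for two members of the sequence and [L] for the ideal generated by the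
    others. The number [s] measures extra order of vanishing: it is 1 under condition (iii) and can
    be taken to be 0 otherwise. *)
Variables (m L : set A) (k s : nat) (a b : A).
Hypotheses (mI : is_ideal m) (m1 : ~ m 1).
Hypothesis munit : forall x, ~ m x -> exists y, y * x = 1.
Hypothesis hA : noetherian A.
Hypotheses (LI : is_ideal L) (Lk : L `<=` ideal_pow m k).
Hypotheses (ak : ideal_pow m (k + s) a) (bk : ideal_pow m (k + s) b).
Hypothesis hab : regular_mod L [:: a; b].
Hypothesis hbase : forall u z, m u -> ideal_pow m (1 + s) z ->
  m `<=` ideal_adj (ideal_adj L u) z -> False.

Let regL r : L (a * r) -> L r. Proof. by case: hab => + _; apply. Qed.

(** The sign is chosen so that comparing two such expressions yields a relation of the shape
    required by [regular_pair_rel]. *)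
Definition pair_rel (g p x y : A) : Prop := L (p * g - (b * x - a * y)).

Definition colon_pow (n : nat) (g : A) : Prop :=
  forall w, ideal_pow m n w -> exists x y, pair_rel g w x y.

Lemma colon_pow_mul n g u : m u -> colon_pow n.+1 g -> colon_pow n (u * g).
Proof.
move=> hu hg w hw; have [|x [y h]] := hg (u * w); first exact: ideal_mulW.
by exists x, y; rewrite /pair_rel mulrA [w * u]mulrC.
Qed.

(** Eliminating g between the two relations gives b (z x' - p x) = a (z y' - p y) modulo L, a Koszul
    relation. *)
Lemma pair_rel_minor g z p x y x' y' :
  pair_rel g z x y -> pair_rel g p x' y' ->
  exists d, L (z * x' - p * x - a * d).
Proof.
move=> h h'.
have [|d [hd _]] := @regular_pair_rel _ L a b (z * x' - p * x)
   (z * y' - p * y) LI hab.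
  rewrite (_ : _ - _ = p * (z * g - (b * x - a * y))
    - z * (p * g - (b * x' - a * y'))); last by ring.
  in_ideal.
by exists d; rewrite [a * d]mulrC.
Qed.

(* For [z, p \in m^n] write [z g = b x - a y] and [p g = b x' - a y'] modulo
   [L]; then [z x' - p x] is a multiple [a d] of [a].  Up to multiples of [z],
   the element [d] is the value at [p] of the homomorphism [m^n -> A / (L, z)]
   that sends [a] to [- x] and [b] to [- y]. *)
Definition minors_in_pow (n : nat) : Prop := forall g z p x y x' y' d,
  colon_pow n g -> ideal_pow m (n + s) z -> ideal_pow m n p ->
  pair_rel g z x y -> pair_rel g p x' y' -> L (z * x' - p * x - a * d) ->
  ideal_pow m n d.

(** Linearity in p of the value d, modulo L and z: the representations of r p1 + p2 differ by a
    Koszul multiple c of (a, b), which changes the value by z c once the regular element a is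
    cancelled. *)
Lemma minor_linear g z x y r p1 x1 y1 d1 p2 x2 y2 d2 x3 y3 d3 :
  pair_rel g z x y ->
  pair_rel g p1 x1 y1 -> L (z * x1 - p1 * x - a * d1) ->
  pair_rel g p2 x2 y2 -> L (z * x2 - p2 * x - a * d2) ->
  pair_rel g (r * p1 + p2) x3 y3 -> L (z * x3 - (r * p1 + p2) * x - a * d3) ->
  exists c, L (d3 - r * d1 - d2 - z * c).
Proof.
move=> h h1 hd1 h2 hd2 h3 hd3.
have [|c [hc _]] := @regular_pair_rel _ L a b (x3 - r * x1 - x2)
   (y3 - r * y1 - y2) LI hab.
  rewrite (_ : _ - _ = r * (p1 * g - (b * x1 - a * y1))
    + (p2 * g - (b * x2 - a * y2))
    - ((r * p1 + p2) * g - (b * x3 - a * y3))); last by ring.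
  in_ideal.
exists c; apply: regL.
rewrite (_ : _ * _ = z * (x3 - r * x1 - x2 - c * a)
  + r * (z * x1 - p1 * x - a * d1) + (z * x2 - p2 * x - a * d2)
  - (z * x3 - (r * p1 + p2) * x - a * d3)); last by ring.
in_ideal.
Qed.

(** The value for g at u w is compared with the value for u g at w. Since z is a combination of
    elements of m^(n+s) with coefficients in m, the hypothesis in degree n, applied to u g, yields a
    representation of z u g whose values lie in m^(n+1). It differs from u times the given
    representation of z g by a multiple r of (a, b), which accounts for the term r w. *)
Lemma minor_mul_left n g z u x y : (n < k)%N -> minors_in_pow n ->
  colon_pow n.+1 g -> m u -> ideal_pow m (n.+1 + s) z -> pair_rel g z x y ->
  exists r, forall w x' y' d, ideal_pow m n w ->
    pair_rel g (u * w) x' y' -> L (z * x' - u * w * x - a * d) ->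
    ideal_pow m n.+1 (d + r * w).
Proof.
move=> nk hn hg hu hz hzxy.
have hug := colon_pow_mul hu hg.
have nI := ideal_pow_ideal m n.+1.
(* Those z for which u g has a representation with all values in m^(n+1). They form an ideal because
   representations can be added and scaled. *)
pose Z := [set z | exists x1 y1, pair_rel (u * g) z x1 y1 /\
  forall w x' y', ideal_pow m n w -> pair_rel (u * g) w x' y' ->
  exists d, ideal_pow m n.+1 d /\ L (z * x' - w * x1 - a * d)].
have hZ : is_ideal Z.
  split=> [|z1 z2 [x1 [y1 [h1 hd1]]] [x2 [y2 [h2 hd2]]]
            |c z1 [x1 [y1 [h1 hd1]]]].
  - exists 0, 0; split; first by rewrite /pair_rel (_ : _ - _ = 0);
      [in_ideal|ring].
    move=> w x' y' _ _; exists 0; split; first in_ideal.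
    by rewrite (_ : _ - _ = 0); [in_ideal|ring].
  - exists (x1 + x2), (y1 + y2); split.
      rewrite /pair_rel (_ : _ - _ = (z1 * (u * g) - (b * x1 - a * y1))
        + (z2 * (u * g) - (b * x2 - a * y2))); last by ring.
      in_ideal.
    move=> w x' y' hw hw'; have [d1 [hd1n hd1']] := hd1 w x' y' hw hw'.
    have [d2 [hd2n hd2']] := hd2 w x' y' hw hw'.
    exists (d1 + d2); split; first in_ideal.
    rewrite (_ : _ - _ = (z1 * x' - w * x1 - a * d1)
      + (z2 * x' - w * x2 - a * d2)); last by ring.
    in_ideal.
  - exists (c * x1), (c * y1); split.
      rewrite /pair_rel (_ : _ - _ = c * (z1 * (u * g) - (b * x1 - a * y1)));
        last by ring.
      in_ideal.
    move=> w x' y' hw hw'; have [d1 [hd1n hd1']] := hd1 w x' y' hw hw'.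
    exists (c * d1); split; first in_ideal.
    rewrite (_ : _ - _ = c * (z1 * x' - w * x1 - a * d1)); last by ring.
    in_ideal.
have [|x1 [y1 [h1 hd1]]] := ideal_mul_sub hZ _ hz.
  move=> c z1 hc hz1; have hz1n := ideal_pow_le (leq_addr s n) hz1.
  have [x1 [y1 h1]] := hug z1 hz1n.
  exists (c * x1), (c * y1); split.
    rewrite /pair_rel (_ : _ - _ = c * (z1 * (u * g) - (b * x1 - a * y1)));
      last by ring.
    in_ideal.
  move=> w x' y' hw hw'; have [d hd] := pair_rel_minor h1 hw'.
  exists (c * d); split.
    apply: ideal_mulW => //.
    exact: (hn _ _ _ _ _ _ _ _ hug hz1 hw h1 hw' hd).
  rewrite (_ : _ - _ = c * (z1 * x' - w * x1 - a * d)); last by ring.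
  in_ideal.
(* Both [x1] and [u * x] come from representations of z u g; the scalar r measures their
   difference. *)
have [|r [hr _]] := @regular_pair_rel _ L a b (u * x - x1) (u * y - y1) LI hab.
  rewrite (_ : _ - _ = (z * (u * g) - (b * x1 - a * y1))
    - u * (z * g - (b * x - a * y))); last by ring.
  in_ideal.
exists r => w x' y' d hw hw' hd.
have [|d1 [hd1n hd1']] := hd1 w x' y' hw.
  by rewrite /pair_rel mulrA [w * u]mulrC.
rewrite -(subrK d1 (d + _)); apply: (idealD nI) => //.
apply: (ideal_pow_le nk); apply: Lk; apply: regL.
rewrite (_ : _ * _ = (z * x' - w * x1 - a * d1)
  - (z * x' - u * w * x - a * d) - w * (u * x - x1 - r * a)); last by ring.
in_ideal.
Qed.

(** Let v in m have value dv. Writing p v g in two ways gives v d = p dv - z c modulo L. If d were a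
    unit, m would be contained in (L, p, z), against [hbase]. *)
Lemma minors_in_pow1 : minors_in_pow 1.
Proof.
move=> g z p x y x' y' d hg hz hp hzxy hpxy hd.
rewrite ideal_pow1 //; apply: contrapT => /munit[e he].
rewrite ideal_pow1 // in hp; apply: (hbase hp hz) => v hv.
have [|xv [yv hvxy]] := hg v; first by rewrite ideal_pow1.
have [dv hdv] := pair_rel_minor hzxy hvxy.
have [|c [hc _]] := @regular_pair_rel _ L a b (p * xv - v * x')
   (p * yv - v * y') LI hab.
  rewrite (_ : _ - _ = v * (p * g - (b * x' - a * y'))
    - p * (v * g - (b * xv - a * yv))); last by ring.
  in_ideal.
exists (- e * c), (e * dv).
rewrite (_ : _ - _ = - e * (p * dv - v * d - z * c) + (1 - e * d) * v);
  last by ring.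
rewrite he subrr mul0r addr0; apply: idealMl => //; apply: regL.
rewrite (_ : _ * _ = z * (p * xv - v * x' - c * a)
  + v * (z * x' - p * x - a * d) - p * (z * xv - v * x - a * dv)); last by ring.
in_ideal.
Qed.

(** Modulo m^(n+2) the factors of a product of n + 1 elements of m can be replaced one by one by
    multiples of u; Nakayama's lemma then removes the error term. *)
Lemma pow_principal n u :
  m u -> (forall v, m v -> exists c, forall w, ideal_pow m n w ->
    ideal_pow m n.+2 ((v - c * u) * w)) ->
  forall x, ideal_pow m n.+1 x -> exists r, x = r * u ^+ n.+1.
Proof.
move=> hu hv.
have nI := ideal_pow_ideal m n.+2.
have step i j : (i + j = n.+1)%N -> forall x, ideal_pow m n.+1 x ->
    exists y, ideal_pow m j y /\ ideal_pow m n.+2 (x - u ^+ i * y).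
  elim: i j => [|i IH] j hij x hx.
    by exists x; rewrite -[j]add0n hij expr0 mul1r subrr; split; in_ideal.
  have [|y [hy hxy]] := IH j.+1 _ x hx; first by rewrite addnS.
  (* One factor v of y is traded for c u; the cofactor u^i w lies in m^n, so the error lies in
     m^(n+2). *)
  pose Y := [set y | exists y', ideal_pow m j y' /\
    ideal_pow m n.+2 (u ^+ i * y - u ^+ i.+1 * y')].
  have jI := ideal_pow_ideal m j.
  have hY : is_ideal Y.
    split=> [|y1 y2 [z1 [hz1 h1]] [z2 [hz2 h2]]|c y1 [z1 [hz1 h1]]].
    - exists 0; rewrite !mulr0 subrr; split; in_ideal.
    - exists (z1 + z2); split; first in_ideal.
      rewrite (_ : _ - _ = (u ^+ i * y1 - u ^+ i.+1 * z1)
        + (u ^+ i * y2 - u ^+ i.+1 * z2)); last by ring.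
      in_ideal.
    - exists (c * z1); split; first in_ideal.
      rewrite (_ : _ - _ = c * (u ^+ i * y1 - u ^+ i.+1 * z1)); last by ring.
      in_ideal.
  have [|y' [hy' hyy']] := ideal_mul_sub hY _ hy.
    move=> v w /hv[c hc] hw; exists (c * w); split; first in_ideal.
    rewrite (_ : _ - _ = (v - c * u) * (u ^+ i * w)).
      apply: hc; have <- : (i + j = n)%N by case: hij.
      by apply: ideal_powD => //; apply: ideal_pow_expr.
    by rewrite exprS; ring.
  exists y'; split => //; rewrite -(subrKA (u ^+ i * y)).
  in_ideal.
have adjI := ideal_adj_ideal (u ^+ n.+1) (is_ideal0 A).
have sub : ideal_pow m n.+1 `<=` ideal_adj [set 0] (u ^+ n.+1).
  apply: (nakayama mI m1 munit hA) => // [|x hx]; first exact: ideal_pow_ideal.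
  have [|y [_ hy]] := step n.+1 0%N _ x hx; first by rewrite addn0.
  exists (u ^+ n.+1 * y); split=> //.
  by exists y; rewrite /= mulrC subrr.
by move=> x /sub[r /eqP]; rewrite subr_eq0 => /eqP ->; exists r.
Qed.

Lemma minors_in_powS n : (n.+1 < k)%N ->
  minors_in_pow n.+1 -> minors_in_pow n.+2.
Proof.
move=> nk hn g z p x y x' y' d hg hz hp hzxy hpxy hd.
have nI := ideal_pow_ideal m n.+2.
have hz2 : ideal_pow m n.+2 z by apply: ideal_pow_le hz; apply: leq_addr.
have Ln : L `<=` ideal_pow m n.+2.
  by move=> v /Lk; apply: ideal_pow_le.
have hr u (hu : m u) := minor_mul_left nk hn hg hu hz hzxy.
have [hall|] := pselect (forall u, m u -> exists r, m r /\
    forall w x' y' d, ideal_pow m n.+1 w -> pair_rel g (u * w) x' y' ->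
    L (z * x' - u * w * x - a * d) -> ideal_pow m n.+2 (d + r * w)).
  (* When every r_u lies in m, the products u w have values in m^(n+2). The condition cuts out an
     ideal by [minor_linear], as z and L lie in m^(n+2). *)
  pose T := [set p | ideal_pow m n.+2 p /\ forall x' y' d, pair_rel g p x' y' ->
    L (z * x' - p * x - a * d) -> ideal_pow m n.+2 d].
  have r0 : pair_rel g 0 0 0.
    by rewrite /pair_rel (_ : _ - _ = 0); [in_ideal|ring].
  have d0 : L (z * 0 - 0 * x - a * 0).
    by rewrite (_ : _ - _ = 0); [in_ideal|ring].
  have hT : is_ideal T.
    have comb r p1 p2 : T p1 -> T p2 -> T (r * p1 + p2).
      move=> [hp1 h1] [hp2 h2]; split.
        in_ideal.
      move=> x3 y3 d3 h3 hd3.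
      have [x1 [y1 h1']] := hg p1 hp1; have [x2 [y2 h2']] := hg p2 hp2.
      have [d1 hd1] := pair_rel_minor hzxy h1'.
      have [d2 hd2] := pair_rel_minor hzxy h2'.
      have [c hc] := minor_linear hzxy h1' hd1 h2' hd2 h3 hd3.
      rewrite (_ : d3 = (d3 - r * d1 - d2 - z * c) + z * c + r * d1 + d2);
        last by ring.
      apply: (idealD nI); last exact: h2 h2' hd2.
      apply: (idealD nI); last by apply: (idealMl _ nI); apply: h1 h1' hd1.
      by apply: (idealD nI); [apply: Ln|in_ideal].
    have T0 : T 0.
      split; first in_ideal.
      move=> x1 y1 d1 h1 hd1.
      have h1' : pair_rel g (1 * 0 + 0) x1 y1 by rewrite mulr0 addr0.
      have [|c hc] := minor_linear hzxy r0 d0 r0 d0 h1' (d3 := d1).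
        by rewrite mulr0 addr0.
      rewrite (_ : d1 = (d1 - 1 * 0 - 0 - z * c) + z * c); last by ring.
      by apply: (idealD nI); [apply: Ln|in_ideal].
    split=> // [p1 p2 h1 h2|r p1 h1]; first by rewrite -[p1]mul1r; apply: comb.
    by rewrite -[r * p1]addr0; apply: comb.
  suff [_ /(_ x' y' d)] : T p by apply.
  apply: ideal_mul_sub hT _ _ hp => u w hu hw; split; first exact: ideal_mulW.
  move=> x1 y1 d1 h1 hd1; have [r [mr hrw]] := hall u hu.
  rewrite -(addrK (r * w) d1); apply: (idealB nI); first exact: hrw h1 hd1.
  exact: ideal_mulW.
(* Otherwise some r_u is a unit; then m^(n+1) is principal and contains the regular pair a, b, which
   is impossible. *)
move=> hex; exfalso.
have [u [hu [r0 [mr0 hr0]]]] : exists u, m u /\ exists r, ~ m r /\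
    forall w x' y' d, ideal_pow m n.+1 w -> pair_rel g (u * w) x' y' ->
    L (z * x' - u * w * x - a * d) -> ideal_pow m n.+2 (d + r * w).
  apply: contrapT => hno; apply: hex => u hu; have [r h] := hr u hu.
  exists r; split=> //; apply: contrapT => nr; apply: hno.
  by exists u; split=> //; exists r.
have [e he] := munit mr0.
have pr : forall x, ideal_pow m n.+1 x -> exists r, x = r * u ^+ n.+1.
  (* The product u v w is read both as u (v w) and as v (u w): its value is congruent to - r0 v w
     and to - r u w modulo m^(n+2), so v acts on m^n like e r u. *)
  apply: pow_principal => // v hv; have [r h] := hr v hv.
  exists (e * r) => w hw.
  have [|x1 [y1 h1]] := hg (u * (v * w)).
    by apply: ideal_mulW => //; apply: ideal_mulW.
  have [d1 hd1] := pair_rel_minor hzxy h1.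
  have k1 := hr0 (v * w) _ _ _ (ideal_mulW hv hw) h1 hd1.
  have uvE : u * (v * w) = v * (u * w) by ring.
  rewrite uvE in h1 hd1.
  have k2 := h (u * w) _ _ _ (ideal_mulW hu hw) h1 hd1.
  rewrite (_ : _ * _ = e * ((d1 + r0 * (v * w)) - (d1 + r * (u * w)))
    + (1 - e * r0) * (v * w)); last by ring.
  by rewrite he subrr mul0r addr0; in_ideal.
have nks : (n.+1 <= k + s)%N by apply: leq_trans (ltnW nk) (leq_addr _ _).
have [ra ha] := pr a (ideal_pow_le nks ak).
have [rb hb] := pr b (ideal_pow_le nks bk).
have mu : m (u ^+ n.+1) by rewrite exprS; in_ideal.
have Lm : L `<=` m.
  move=> v /Ln /(@ideal_pow_le _ m 1 n.+2 isT); rewrite ideal_pow1 //.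
by apply: (regular_pair_not_principal mI m1 LI Lm hab mu (r1 := ra) (r2 := rb));
  rewrite -?ha -?hb subrr; in_ideal.
Qed.

(** The coefficients are themselves values at p: taking z = a, with a g = b 0 - a (- g), gives the
    value x, and taking z = b, with b g = b g - a 0, gives the value y. *)
Lemma colon_pow_coefs g p x y : (0 < k)%N -> colon_pow k g ->
  ideal_pow m k p -> pair_rel g p x y -> ideal_pow m k x /\ ideal_pow m k y.
Proof.
move=> k0 hg hp hpxy.
have h n : (n < k)%N -> minors_in_pow n.+1.
  elim: n => [_|n IH nk]; first exact: minors_in_pow1.
  exact: minors_in_powS nk (IH (ltnW nk)).
have hk : minors_in_pow k by rewrite -(prednK k0); apply: h; rewrite prednK.
split.
  have ha : pair_rel g a 0 (- g).
    by rewrite /pair_rel (_ : _ - _ = 0); [in_ideal|ring].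
  apply: (hk _ _ _ _ _ _ _ _ hg ak hp ha hpxy).
  by rewrite (_ : _ - _ = 0); [in_ideal|ring].
have hb : pair_rel g b g 0.
  by rewrite /pair_rel (_ : _ - _ = 0); [in_ideal|ring].
apply: (hk _ _ _ _ _ _ _ _ hg bk hp hb hpxy).
rewrite (_ : _ - _ = - (p * g - (b * x - a * y))); last by ring.
in_ideal.
Qed.

End Core.

(** * Coefficients along the whole sequence in a local ring *)

Section LocalCoefs.
Variable A : comNzRingType.
Variables (m : set A) (k s g : nat) (z : 'I_g -> A).
Hypotheses (mI : is_ideal m) (m1 : ~ m 1).
Hypothesis munit : forall x, ~ m x -> exists y, y * x = 1.
Hypothesis hA : noetherian A.
Hypotheses (hk : (2 <= k)%N) (hg : (2 <= g)%N).
Hypothesis hz : forall i, ideal_pow m (k + s) (z i).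
Hypothesis zreg : regular_mod [set 0] [seq z i | i <- enum 'I_g].
Hypothesis hcase : [\/ s = 1%N, (3 <= g)%N |
  forall u v, m u -> m v ->
    ~ m `<=` ideal_adj (ideal_adj [set 0] u) v].

Let pow_m n x : (0 < n)%N -> ideal_pow m n x -> m x.
Proof. by move=> n0 hx; have := ideal_pow_le n0 hx; rewrite ideal_pow1. Qed.

Let zm i : m (z i).
Proof. by apply: pow_m (hz i); case: k hk. Qed.

Let zk i : ideal_pow m k (z i).
Proof. exact: (ideal_pow_le (leq_addr s k) (hz i)). Qed.

Let span_ideal t : is_ideal (ideal_span [set 0 : A] t).
Proof. exact/ideal_span_ideal/is_ideal0. Qed.

Let span_sub (t : seq 'I_g) K : is_ideal K -> (forall i, K (z i)) ->
  ideal_span [set 0] [seq z i | i <- t] `<=` K.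
Proof.
move=> hK hz'; apply: ideal_span_sub => //; first by move=> _ ->; in_ideal.
by move=> _ /mapP[i _ ->].
Qed.

Let absorb E v : is_ideal E -> ideal_pow m 2 v -> m `<=` ideal_adj E v ->
  m `<=` E.
Proof.
move=> hE hv hm; apply: (nakayama mI m1 munit hA) => // x /hm[r hr].
exists (x - r * v); split => //; rewrite subKr.
rewrite ideal_powS ideal_pow1 // in hv.
by apply: (idealMl _ (@ideal_mul_ideal _ _ _)).
Qed.

(** For a given i a second index j is chosen, and the sequence is permuted so that z i and z j come
    last. Modulo the ideal L of the others, c i is up to sign a coefficient of the pair, and
    [colon_pow_coefs] applies once its hypothesis on generators of m is checked. *)
Lemma local_coefs h (c : 'I_g -> A) p :
  (forall w, ideal_pow m k w -> exists d : 'I_g -> A,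
    w * h = \sum_i d i * z i) ->
  ideal_pow m k p -> p * h = \sum_i c i * z i ->
  forall i, ideal_pow m k (c i).
Proof.
move=> hh hp hc i.
have [j ij] : exists j, j != i.
  have [i0|i0] := eqVneq (i : nat) 0%N.
    by exists (Ordinal hg); rewrite -val_eqE /= i0.
  by exists (Ordinal (ltnW hg)); rewrite -val_eqE /= eq_sym.
pose rest := [seq l <- enum 'I_g | (l != i) && (l != j)].
have perm : perm_eq (enum 'I_g) (rest ++ [:: i; j]).
  apply: uniq_perm; first exact: enum_uniq.
    rewrite cat_uniq filter_uniq ?enum_uniq //= !mem_filter !inE.
    by rewrite !eqxx /= !andbF eq_sym ij.
  move=> l; rewrite mem_enum mem_cat [l \in rest]mem_filter mem_enum !inE andbT.
  by case: (l == i); case: (l == j).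
have mz : {in [seq z l | l <- enum 'I_g], forall y, m y}.
  by move=> _ /mapP[l _ ->].
have regr : regular_mod [set 0] ([seq z l | l <- rest] ++ [:: z i; z j]).
  have := regular_mod_perm mI m1 munit hA (is_ideal0 A) mz (perm_map z perm).
  by rewrite map_cat; apply.
pose L := ideal_span [set 0] [seq z l | l <- rest].
have LI : is_ideal L := span_ideal _.
have hij := regular_mod_cat regr.
have Lk : L `<=` ideal_pow m k by apply: span_sub => //; in_ideal.
have Lm : L `<=` m by apply: span_sub.
have zL l : l != i -> l != j -> L (z l).
  move=> li lj; apply: mem_ideal_span; first exact: is_ideal0.
  by apply: map_f; rewrite mem_filter li lj mem_enum.
have sumL w d : w * h = \sum_l d l * z l ->
    pair_rel L (z i) (z j) h w (d j) (- d i).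
  move=> e; rewrite /pair_rel e (bigD1 i) //= (bigD1 j) //=.
  rewrite (_ : _ - _ = \sum_(l | (l != i) && (l != j)) d l * z l);
    last by ring.
  by apply: ideal_sum => // l /andP[li lj]; apply: (idealMl _ LI); apply: zL.
have hbase u v : m u -> ideal_pow m (1 + s) v ->
    m `<=` ideal_adj (ideal_adj L u) v -> False.
  move=> hu hv huv; have hLu := ideal_adj_ideal u LI.
  have [s1|/eqP s1] := eqVneq s 1%N.
    have hmu : m `<=` ideal_adj L u.
      by apply: absorb huv; rewrite // -[2%N]/(1 + 1)%N -{2}s1.
    have [[ri hi] [rj hj]] := (hmu _ (zm i), hmu _ (zm j)).
    exact: (regular_pair_not_principal mI m1 LI Lm hij hu hi hj).
  have hvm : m v by apply: pow_m hv.
  have [r0|[t [l rE]]] : rest = [::] \/ exists t l, rest = rcons t l.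
  - by case/lastP: (rest) => [|t l]; [left|right; exists t, l].
  (* No further elements means g = 2 and L = 0, so the third alternative of [hcase] applies. *)
  - case: hcase => [//|g3|]; last first.
      by move/(_ u v hu hvm); apply; rewrite /L r0 in huv.
    by move: (perm_size perm) g3; rewrite size_enum_ord r0 /= => ->.
  (* One element z l is split off from L. It lies in m^2, so u and v already generate m modulo L',
     where z l, z i, z j is a regular sequence of length three. *)
  pose L' := ideal_span [set 0] [seq z l | l <- t].
  have L'I : is_ideal L' := span_ideal _.
  have LE : L = ideal_adj L' (z l).
    by rewrite /L rE map_rcons -cats1 ideal_span_cat.
  rewrite rE map_rcons cat_rcons in regr.
  have hL'u := ideal_adj_ideal u L'I.
  have hL'uv := ideal_adj_ideal v hL'u.
  have := regular_triple_not_two_generated mI m1 L'I _ (regular_mod_cat regr)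
    hu hvm.
  apply => //; first exact: span_sub.
  apply: (absorb hL'uv (ideal_pow_le hk (zk l))).
  by rewrite (ideal_adjC v _ hL'u) (ideal_adjC u _ L'I) -LE.
have k0 : (0 < k)%N by case: k hk.
have := colon_pow_coefs mI m1 munit hA LI Lk (hz i) (hz j) hij hbase k0 _ hp
   (sumL _ _ hc).
case=> [w /hh[d /sumL hd]|_]; first by exists (d j), (- d i).
by move=> hci; rewrite -[c i]opprK; in_ideal.
Qed.

End LocalCoefs.

(** * Localization at a prime *)

Section Localize.
Variables (R : comNzRingType) (P : primeIdeal R).
Local Notation A := (localization P).
Local Notation f := (to_loc P).

Let PI : is_ideal P. Proof. by case: (prime_setP P). Qed.
Let P1 : ~ prime_set P 1. Proof. by case: (prime_setP P). Qed.
Let PM x y : ~ prime_set P x -> ~ prime_set P y -> ~ prime_set P (x * y).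
Proof. by move=> hx hy; case: (prime_setP P) => _ _ h /h[]. Qed.

Lemma to_loc_eqP x y : f x = f y <-> exists t, ~ prime_set P t /\ t * x = t * y.
Proof.
split=> [/Localization.mkP[u /=]|[t [ht e]]].
  rewrite !mulr1 => e; exists (sval u); split=> //.
  exact: Localization.denomP.
apply/Localization.mkP.
exists (exist (fun s => `[< ~ prime_set P s >]) t (asboolT ht)).
by rewrite /= !mulr1.
Qed.

Lemma loc_fracP (a : A) : exists t x, ~ prime_set P t /\ f t * a = f x.
Proof.
elim/Localization.mk_ind: a => -[x t]; exists (sval t), x.
split; first exact: Localization.denomP.
rewrite -[LHS]/(Localization.mul _ _) Localization.mk_mul.
by apply/Localization.mkP; exists (Localization.denom1 P) => /=; ring.
Qed.

Lemma to_loc_inv t : ~ prime_set P t -> exists e, e * f t = 1.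
Proof.
move=> ht.
pose u : Localization.denom P :=
  exist (fun s => `[< ~ prime_set P s >]) t (asboolT ht).
exists (Localization.mk (1, u)).
rewrite -[LHS]/(Localization.mul _ _) Localization.mk_mul.
by apply/Localization.mkP; exists (Localization.denom1 P) => /=; ring.
Qed.

Lemma loc_ideal_cancel (K : set A) t a : is_ideal K -> ~ prime_set P t ->
  K (f t * a) -> K a.
Proof.
move=> hK /to_loc_inv[e he] h; rewrite -[a]mul1r -he -mulrA.
exact: (idealMl _ hK).
Qed.

(** The extension of I to the local ring, described by denominators; [ideal_gen_ext] identifies it
    with the ideal generated by the image. *)
Definition ideal_ext (I : set R) : set A :=
  [set a | exists t x, [/\ ~ prime_set P t, I x & f t * a = f x]].

Lemma ideal_ext_ideal I : is_ideal I -> is_ideal (ideal_ext I).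
Proof.
move=> hI; split=> [|a b [t [x [ht hx e]]] [u [y [hu hy e']]]
                    |a b [t [x [ht hx e]]]].
- by exists 1, 0; split; [exact: P1|in_ideal|rewrite mulr0 rmorph0].
- exists (t * u), (u * x + t * y); split; [exact: PM|in_ideal|].
  by rewrite !(rmorphM, rmorphD) /= -e -e'; ring.
- have [u [y [hu e']]] := loc_fracP a.
  exists (u * t), (y * x); split; [exact: PM|in_ideal|].
  by rewrite !rmorphM /= -e -e'; ring.
Qed.

Lemma mem_ideal_ext (I : set R) x : I x -> ideal_ext I (f x).
Proof. by move=> hx; exists 1, x; rewrite rmorph1 mul1r; split. Qed.

Lemma ideal_ext_toP I x : is_ideal I ->
  ideal_ext I (f x) <-> exists t, ~ prime_set P t /\ I (t * x).
Proof.
move=> hI; split=> [[t [y [ht hy]]]|[t [ht h]]].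
  rewrite -rmorphM => /to_loc_eqP[u [hu e]]; exists (u * t).
  by split; [exact: PM|rewrite -mulrA e; in_ideal].
by exists t, (t * x); rewrite rmorphM.
Qed.

Lemma ideal_ext_sub I K : is_ideal K -> (forall x, I x -> K (f x)) ->
  ideal_ext I `<=` K.
Proof.
move=> hK h a [t [x [ht hx e]]]; apply: (loc_ideal_cancel hK ht).
by rewrite e; apply: h.
Qed.

Lemma ideal_gen_ext I : is_ideal I -> ideal_gen (f @` I) = ideal_ext I.
Proof.
move=> hI; apply/seteqP; split.
  apply: ideal_gen_sub; first exact: ideal_ext_ideal.
  by move=> _ [x hx <-]; apply: mem_ideal_ext.
apply: ideal_ext_sub; first exact: ideal_gen_ideal.
by move=> x hx; apply: ideal_genW; exists x.
Qed.

Lemma ideal_ext_mul I J : is_ideal I -> is_ideal J ->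
  ideal_ext (ideal_mul I J) = ideal_mul (ideal_ext I) (ideal_ext J).
Proof.
move=> hI hJ; have hM := ideal_mul_ideal (ideal_ext I) (ideal_ext J).
apply/seteqP; split.
  apply: ideal_ext_sub => // x.
  pose K := [set x | ideal_mul (ideal_ext I) (ideal_ext J) (f x)].
  have hK : is_ideal K.
    split=> [|u v hu hv|u v hv]; rewrite /K /mkset.
    - by rewrite rmorph0; in_ideal.
    - by rewrite rmorphD; in_ideal.
    - by rewrite rmorphM; in_ideal.
  move: x; apply: (ideal_mul_sub (K := K)) => // x y hx hy.
  by rewrite /K /mkset rmorphM; apply: ideal_mulW; apply: mem_ideal_ext.
apply: ideal_mul_sub; first exact/ideal_ext_ideal/ideal_mul_ideal.
move=> a b [t [x [ht hx e]]] [u [y [hu hy e']]].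
exists (t * u), (x * y); split; [exact: PM|exact: ideal_mulW|].
by rewrite !rmorphM /= -e -e'; ring.
Qed.

Lemma ideal_ext_pow I n : is_ideal I ->
  ideal_ext (ideal_pow I n) = ideal_pow (ideal_ext I) n.
Proof.
move=> hI; elim: n => [|n IH].
  apply/seteqP; split=> // a _.
  by have [t [x [ht e]]] := loc_fracP a; exists t, x.
by rewrite !ideal_powS -IH ideal_ext_mul //; apply: ideal_pow_ideal.
Qed.

Definition loc_max : set A := ideal_ext P.

Lemma loc_max_ideal : is_ideal loc_max. Proof. exact: ideal_ext_ideal. Qed.

Lemma loc_max_toP x : loc_max (f x) <-> prime_set P x.
Proof.
split=> [/(ideal_ext_toP _ PI)[t [ht]]|]; last exact: mem_ideal_ext.
by case: (prime_setP P) => _ _ h /h[].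
Qed.

Lemma loc_max_proper : ~ loc_max 1.
Proof. by rewrite -(rmorph1 f) => /loc_max_toP. Qed.

Lemma loc_max_unit a : ~ loc_max a -> exists b, b * a = 1.
Proof.
have [t [x [ht e]]] := loc_fracP a => ha.
have hx : ~ prime_set P x by move=> hx; apply: ha; exists t, x.
by have [d hd] := to_loc_inv hx; exists (d * f t); rewrite -mulrA e.
Qed.

Lemma symbolic_powerP n x :
  symbolic_power P n x <-> ideal_pow loc_max n (f x).
Proof.
rewrite /symbolic_power /preimage /= ideal_gen_ext; last exact: ideal_pow_ideal.
by rewrite ideal_ext_pow.
Qed.

Definition ideal_contr (K : set A) : set R := f @^-1` K.

Lemma ideal_contr_ideal K : is_ideal K -> is_ideal (ideal_contr K).
Proof.
move=> hK; split=> [|x y hx hy|r x hx]; rewrite /ideal_contr /preimage /mkset.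
- by rewrite rmorph0; in_ideal.
- by rewrite rmorphD /=; in_ideal.
- by rewrite rmorphM /=; in_ideal.
Qed.

Lemma ideal_contrK K : is_ideal K -> ideal_ext (ideal_contr K) = K.
Proof.
move=> hK; apply/seteqP; split; first exact: ideal_ext_sub.
move=> a ha; have [t [x [ht e]]] := loc_fracP a.
exists t, x; split=> //; rewrite /ideal_contr /preimage /mkset -e.
by in_ideal.
Qed.

Lemma loc_noetherian : noetherian R -> noetherian A.
Proof.
move=> hR K hK; have [s hs] := hR _ (ideal_contr_ideal hK).
exists (map f s); rewrite -{1}(ideal_contrK hK) hs.
have hG := ideal_gen_ideal [set` map f s].
apply/seteqP; split.
  have sub : ideal_gen [set` s] `<=` ideal_contr (ideal_gen [set` map f s]).
    apply: ideal_gen_sub; first exact: ideal_contr_ideal.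
    by move=> x xs; apply: ideal_genW => /=; apply: map_f.
  exact: ideal_ext_sub.
apply: ideal_gen_sub; first exact/ideal_ext_ideal/ideal_gen_ideal.
by move=> _ /mapP[x xs ->]; apply: mem_ideal_ext; apply: ideal_genW.
Qed.

Lemma ideal_ext_adj I x : is_ideal I ->
  ideal_ext (ideal_adj I x) = ideal_adj (ideal_ext I) (f x).
Proof.
move=> hI; have hE := ideal_ext_ideal hI.
apply/seteqP; split.
  apply: ideal_ext_sub; first exact: ideal_adj_ideal.
  move=> y [r h]; exists (f r); rewrite -rmorphM -rmorphB.
  exact: mem_ideal_ext.
apply: ideal_adj_sub; first exact/ideal_ext_ideal/ideal_adj_ideal.
- apply: ideal_ext_sub; first exact/ideal_ext_ideal/ideal_adj_ideal.
  by move=> y hy; apply: mem_ideal_ext; apply: sub_ideal_adj.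
- by apply: mem_ideal_ext; apply: mem_ideal_adj.
Qed.

Lemma ideal_ext0 : ideal_ext [set 0] = [set 0].
Proof.
apply/seteqP; split.
  apply: ideal_ext_sub; first exact: is_ideal0.
  by move=> _ ->; rewrite rmorph0.
by move=> _ ->; apply: (ideal0 (ideal_ext_ideal (is_ideal0 R))).
Qed.

Lemma loc_regular_mod I s : is_ideal I -> regular_mod I s ->
  regular_mod (ideal_ext I) (map f s).
Proof.
elim: s I => // x s IH I hI /= [hx hs]; split; last first.
  by rewrite -ideal_ext_adj //; apply: IH => //; apply: ideal_adj_ideal.
move=> a [t [i [ht hi e]]]; have [u [y [hu e']]] := loc_fracP a.
have /to_loc_eqP[w [hw ew]] : f (t * x * y) = f (u * i).
  by rewrite !rmorphM /= -e -e'; ring.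
exists (w * t * u), (w * t * y); split; first by do 2?apply: PM.
  apply: hx; rewrite (_ : x * _ = w * (t * x * y)); last by ring.
  by rewrite ew; in_ideal.
by rewrite !rmorphM -mulrA e'.
Qed.

Lemma prime_contr K : is_prime_ideal K -> is_prime_ideal (ideal_contr K).
Proof.
case=> hK K1 KM; split; first exact: ideal_contr_ideal.
  by rewrite /ideal_contr /preimage /mkset rmorph1.
by move=> x y; rewrite /ideal_contr /preimage /mkset rmorphM; apply: KM.
Qed.

Lemma ext_contr_prime (Q : set R) x : is_prime_ideal Q -> Q `<=` P ->
  ideal_ext Q (f x) -> Q x.
Proof.
by case=> hQ _ QM QP /(ideal_ext_toP _ hQ)[t [ht /QM[/QP|]]].
Qed.

Lemma prime_ext (Q : set R) : is_prime_ideal Q -> Q `<=` P ->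
  is_prime_ideal (ideal_ext Q).
Proof.
move=> hQ QP; have [QI Q1 QM] := hQ; have hE := ideal_ext_ideal QI.
split=> // [|a b].
  by rewrite -(rmorph1 f) => /(ext_contr_prime hQ QP).
have [t [x [ht e]]] := loc_fracP a; have [u [y [hu e']]] := loc_fracP b => h.
have /(ext_contr_prime hQ QP)/QM[hx|hy] : ideal_ext Q (f (x * y)).
  rewrite rmorphM /= -e -e' (_ : _ * _ = f t * f u * (a * b)); last by ring.
  by in_ideal.
- by left; exists t, x.
- by right; exists u, y.
Qed.

(** Extension and contraction carry chains of primes inside P to chains of primes of the local ring
    and back. *)
Lemma loc_krull_dim g : has_height P g -> has_krull_dim A g.
Proof.
case=> [[p [[pp plt] pg]] hmax]; split.
  have p_le i j : (i <= j)%N -> (j <= g)%N -> p i `<=` p j.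
    elim: j => [|j IH]; first by rewrite leqn0 => /eqP -> _ x.
    rewrite leq_eqVlt => /orP[/eqP -> _ x|ij jg]; first by [].
    by have [h _] := plt j jg; apply: subset_trans (IH ij (ltnW jg)) h.
  have pP i : (i <= g)%N -> p i `<=` P.
    by move=> ig; rewrite -pg; apply: p_le (leqnn g).
  exists (fun i => ideal_ext (p i)); split=> i ig.
    by apply: prime_ext; [apply: pp|apply: pP].
  have [hsub hne] := plt i ig; split.
    by move=> a [t [x [ht hx e]]]; exists t, x; split=> //; apply: hsub.
  move=> h; apply: hne => x hx.
  apply: (ext_contr_prime (pp i (ltnW ig)) (pP i (ltnW ig))).
  by apply: h; apply: mem_ideal_ext.
move=> n q [qp qlt].
pose r i := ideal_contr (q i).
have rp i : (i <= n)%N -> is_prime_ideal (r i) by move=> /qp/prime_contr.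
have rlt i : (i < n)%N -> r i `<` r i.+1.
  move=> hin; have [hsub hne] := qlt i hin.
  split; first by move=> x; apply: hsub.
  move=> h; apply: hne.
  have [qi _ _] := qp i (ltnW hin); have [qi' _ _] := qp i.+1 hin.
  rewrite -(ideal_contrK qi) -(ideal_contrK qi') => a [t [x [ht hx e]]].
  by exists t, x; split=> //; apply: h.
have rP : r n `<=` P.
  move=> x hx; apply: contrapT => /to_loc_inv[e he].
  have [qI q1 _] := qp n (leqnn n); apply: q1; rewrite -he.
  exact: (idealMl _ qI).
(* The height bounds only chains that end at P, so P is appended when the contracted chain stops
   below it. *)
have [rE|rne] := pselect (r n = P); first by apply: (hmax n r).
apply: ltnW; apply: (hmax n.+1 (fun i => if (i <= n)%N then r i else P)).
  split=> i; first by move=> _; case: ifP => [/rp //|_]; apply: prime_setP.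
  rewrite ltnS => hi; rewrite hi; case: ifP => [|/negbT]; first exact: rlt.
  rewrite -ltnNge ltnS => ni; have -> : i = n by apply/eqP; rewrite eqn_leq hi.
  split=> // h; apply: rne; apply/seteqP; split=> //.
by rewrite ltnn.
Qed.

Lemma loc_regular_local u v : noetherian R -> has_height P 2 ->
  loc_max u -> loc_max v ->
  loc_max `<=` ideal_adj (ideal_adj [set 0] u) v -> regular_local_ring A.
Proof.
move=> hR hP hu hv h; have mI := loc_max_ideal.
have proper_sub K : is_ideal K -> ~ K 1 -> K `<=` loc_max.
  move=> hK K1 a ha; apply: contrapT => /loc_max_unit[b hb]; apply: K1.
  by rewrite -hb; apply: (idealMl _ hK).
split; first exact: loc_noetherian.
exists loc_max; split.
- split=> //; first exact: loc_max_proper.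
  by move=> K hK mK /(proper_sub K hK) Km; apply/seteqP.
- move=> N [hN N1 Nmax]; apply/esym/Nmax => //; last exact: loc_max_proper.
  exact: proper_sub.
- exists 2%N, (fun i : 'I_2 => if i == ord0 then u else v).
  split; first exact: loc_krull_dim.
  apply/seteqP; split; last first.
    by apply: ideal_gen_sub => // _ [i _ <-]; case: ifP.
  have hG :=
    ideal_gen_ideal (range (fun i : 'I_2 => if i == ord0 then u else v)).
  apply: (subset_trans h); apply: ideal_adj_sub => //.
    apply: ideal_adj_sub => //; first by move=> _ ->; in_ideal.
    by apply: ideal_genW; exists ord0.
  by apply: ideal_genW; exists ord_max.
Qed.

End Localize.

(** * Regular sequences and their syzygies *)

Lemma regular_mod_take (A : comNzRingType) (L : set A) (s : seq A) :
  (forall i r, (i < size s)%N ->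
    ideal_span L (take i s) (s`_i * r) -> ideal_span L (take i s) r) ->
  regular_mod L s.
Proof.
elim: s L => // x s IH L h; split; first by move=> r; apply: (h 0%N).
by apply: IH => i r hi; apply: (h i.+1).
Qed.

Section RegularSequence.
Variables (R : comNzRingType) (g : nat) (z : 'I_g -> R).
Hypothesis hz : regular_sequence z.

Lemma regular_sequence_mod : regular_mod [set 0] [seq z i | i <- enum 'I_g].
Proof.
apply: regular_mod_take => i r; rewrite size_map size_enum_ord => ig.
have -> : ideal_span [set 0] (take i [seq z i | i <- enum 'I_g])
    = ideal_gen (z @` [set j : 'I_g | (j < Ordinal ig)%N]).
  rewrite -ideal_gen_span; congr ideal_gen; apply/seteqP; split=> y /=.
    rewrite -map_take => /mapP[j hj ->]; exists j => //=.
    by rewrite in_take ?mem_enum // index_enum_ord in hj.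
  move=> [j hj <-]; rewrite -map_take; apply: map_f.
  by rewrite in_take ?mem_enum // index_enum_ord.
rewrite (nth_map (Ordinal ig)) ?size_enum_ord //.
have -> : nth (Ordinal ig) (enum 'I_g) i = Ordinal ig.
  exact: nth_ord_enum (Ordinal ig) (Ordinal ig).
by case: hz => + _; apply.
Qed.

(** Induction on the length n of the relation, with the full ideal fixed: regularity writes the last
    coefficient as a combination of earlier z_l with coefficients b_l. Substituting this leaves a
    shorter relation with coefficients d_j + b_j z_n, which lie in the ideal by induction. *)
Lemma regular_sequence_syzygy (c : 'I_g -> R) i :
  \sum_j c j * z j = 0 -> ideal_gen (range z) (c i).
Proof.
have J := ideal_gen_ideal (range z).
have zJ j : ideal_gen (range z) (z j) by apply: ideal_genW; exists j.
suff H n (d : 'I_g -> R) : (n <= g)%N ->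
    \sum_(j : 'I_g | (j < n)%N) d j * z j = 0 ->
    forall j : 'I_g, (j < n)%N -> ideal_gen (range z) (d j).
  move=> e; apply: (H g) => //; rewrite -[RHS]e; apply: eq_bigl => j.
  exact: ltn_ord.
elim: n d => [//|n IH] d ng.
pose i0 := Ordinal ng.
have lt_S (j : 'I_g) : (j < n.+1)%N && (j != i0) = (j < n)%N.
  by rewrite ltnS (ltn_neqAle j n) andbC.
rewrite (bigD1 i0) //= (eq_bigl _ _ lt_S) => e.
have [h _] := hz.
have /ideal_gen_rangeP[b hb] :
    ideal_gen (z @` [set j : 'I_g | (j < i0)%N]) (d i0).
  apply: h; apply/ideal_gen_rangeP; exists (fun j => - d j).
  under eq_bigr do rewrite mulNr.
  by apply/eqP; rewrite sumrN mulrC -addr_eq0 e.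
have {}IH := IH (fun j => d j + b j * z i0) (ltnW ng).
have dJ : forall j : 'I_g, (j < n)%N -> ideal_gen (range z) (d j).
  move=> j jn; rewrite -(addrK (b j * z i0) (d j)).
  apply: (idealB J); last exact: (idealMl _ J).
  apply: IH => //; rewrite -[RHS]e hb mulr_suml -big_split /=.
  by apply: eq_bigr => l _; ring.
move=> j; rewrite ltnS leq_eqVlt => /orP[/eqP jn|/dJ //].
have -> : j = i0 by apply: val_inj.
by rewrite hb; apply: ideal_sum => // l _; apply: (idealMl _ J).
Qed.

End RegularSequence.

(** * Equality of I^2 and I J *)

Theorem theorem1p2 (R : comNzRingType) (hR : noetherian R)
    (P : primeIdeal R) (g k : nat) (hP : has_height P g)
    (hg : (2 <= g)%N) (hk : (2 <= k)%N)
    (z : 'I_g -> R) (hz : regular_sequence z)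
    (hzP : forall i, symbolic_power P k (z i)) :
  let J := ideal_gen (range z) in
  let I := ideal_colon J (symbolic_power P k) in
  (~ regular_local_ring (localization P)
   \/ (regular_local_ring (localization P) /\ (3 <= g)%N)
   \/ [/\ regular_local_ring (localization P), g = 2%N &
          forall i, symbolic_power P k.+1 (z i)]) ->
  ideal_pow I 2 = ideal_mul I J.
Proof.
move=> J I hcase.
pose f := to_loc P; pose m := @loc_max _ P.
have mI : is_ideal m := @loc_max_ideal _ P.
have JI : is_ideal J := ideal_gen_ideal _.
have JP x : J x <-> exists c, x = \sum_i c i * z i.
  rewrite -(ideal_gen_rangeP z predT) /J.
  suff -> : range z = z @` [set j | predT j] by [].
  by congr (_ @` _); apply/seteqP; split.
have SI : is_ideal (symbolic_power P k).
  exact/ideal_contr_ideal/ideal_gen_ideal.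
have JS : J `<=` symbolic_power P k by apply: ideal_gen_sub => // _ [i _ <-].
have JsubI : J `<=` I by move=> x hx y _; in_ideal.
have II : is_ideal I.
  split=> [y _|x y hx hy w hw|a x hx w hw]; rewrite /= ?mul0r ?mulrDl -?mulrA.
  - by in_ideal.
  - by apply: (idealD JI); [apply: hx|apply: hy].
  - by apply: (idealMl _ JI); apply: hx.
(* For g = 2, condition (i) gives the third alternative: two generators of m would make the local
   ring regular of dimension two. Condition (iii) gives s = 1. *)
have [s hs hcase'] : exists2 s, forall i, ideal_pow m (k + s) (f (z i)) &
    [\/ s = 1%N, (3 <= g)%N | forall u v, m u -> m v ->
      ~ m `<=` ideal_adj (ideal_adj [set 0] u) v].
  have h0 i : ideal_pow m (k + 0) (f (z i)).
    by rewrite addn0; apply/symbolic_powerP.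
  have [g3|g2] := ltnP 2 g; first by exists 0%N => //; apply: Or32.
  have {}g2 : g = 2%N by apply/eqP; rewrite eqn_leq g2.
  case: hcase => [nreg|[[_ g3]|[_ _ hz1]]].
  - exists 0%N => //; apply: Or33 => u v hu hv huv; apply: nreg.
    by apply: loc_regular_local huv => //; rewrite -g2.
  - by rewrite g2 in g3.
  - exists 1%N; last by apply: Or31.
    by move=> i; rewrite addn1; apply/symbolic_powerP.
have zreg : regular_mod [set 0] [seq f (z i) | i <- enum 'I_g].
  have := @loc_regular_mod _ P _ _ (is_ideal0 R) (regular_sequence_mod hz).
  by rewrite ideal_ext0 -map_comp.
have coefs x p c : I x -> symbolic_power P k p -> p * x = \sum_i c i * z i ->
    forall i, symbolic_power P k (c i).
  move=> hx hp e i; apply/symbolic_powerP.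
  apply: (local_coefs mI (@loc_max_proper _ P) (@loc_max_unit _ P)
    (loc_noetherian hR) hk hg hs zreg hcase' (h := f x) (p := f p)
    (c := fun i => f (c i))).
  (* For w = y / t with y in P^k, also y lies in the symbolic power, so x y is in J; dividing its
     expression by t gives the one for w x. *)
  - move=> w; rewrite /m -ideal_ext_pow; last by case: (prime_setP P).
    move=> [t [y [ht hy ey]]].
    have /JP[d hd] : J (x * y).
      apply: hx; apply/symbolic_powerP; rewrite /m -ideal_ext_pow.
        exact: mem_ideal_ext.
      by case: (prime_setP P).
    have [b hb] := to_loc_inv ht.
    exists (fun i => b * f (d i)).
    under eq_bigr do rewrite -mulrA -rmorphM.
    rewrite -mulr_sumr -rmorph_sum -hd rmorphM /= -ey.
    rewrite (_ : b * _ = (b * f t) * (w * f x)); last by rewrite /f; ring.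
    by rewrite hb mul1r.
  - exact/symbolic_powerP.
  - by rewrite -rmorphM e rmorph_sum; apply: eq_bigr => j _; rewrite rmorphM.
have IS x : I x -> symbolic_power P k x.
  (* In the trivial relation z_1 x = x z_1 the element x is itself a coefficient. *)
  move=> hx; pose i0 := Ordinal (ltnW hg).
  have := coefs x (z i0) (fun j => (j == i0)%:R * x) hx (hzP i0) _ i0.
  rewrite eqxx mul1r; apply; rewrite (bigD1 i0) // eqxx mul1r mulrC.
  by rewrite big1 /= ?addr0 // => j /negPf ->; rewrite !mul0r.
have MI := ideal_mul_ideal I J.
rewrite ideal_powS ideal_pow1 //; apply/seteqP; split; last first.
  apply: ideal_mul_sub; first exact: ideal_mul_ideal.
  by move=> x y hx hy; apply: ideal_mulW => //; apply: JsubI.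
apply: ideal_mul_sub => // x y hx hy.
have /JP[a ha] : J (x * y) by apply: hx; apply: IS.
rewrite ha; apply: ideal_sum => // i _; apply: ideal_mulW; last first.
  by apply: ideal_genW; exists i.
move=> p hp.
have /JP[b hb] : J (p * x) by rewrite mulrC; apply: hx.
have hbS := coefs x p b hx hp hb.
(* The term b_i y is in J because b_i lies in the symbolic power and y in I; the rest is a
   coefficient of a syzygy, both sums being equal to p x y. *)
rewrite -(subrK (b i * y) (a i * p)); apply: (idealD JI); last first.
  by rewrite mulrC; apply: hy.
apply: (regular_sequence_syzygy hz (c := fun j => a j * p - b j * y)).
rewrite (eq_bigr (fun j => p * (a j * z j) - y * (b j * z j))) => [|j _];
  last by rewrite /=; ring.
by rewrite sumrB -!mulr_sumr -ha -hb; ring.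
Qed.
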